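(* Let $X\subset\mathbb{R}^d$ be a finite set with $N$ points, $\mathcal H=\mathbb{R}^X\cong\mathbb{R}^N$ with the Euclidean inner product, and let $Q_1,\dots,Q_n:\mathcal H\to\mathcal H$ be deterministic linear operators with multiscale approximation operators $M_j$. Let $f\in\mathcal H$, $Y=f+\varepsilon$ with $\varepsilon$ a random element of $\mathcal H$ satisfying $\mathbb{E}[\varepsilon]=0$ and $\operatorname{Cov}(\varepsilon)=\sigma^2I$, and $\widetilde f_j=M_jY$ for $j=1,\dots,n$. Suppose that $Q_1,\dots,Q_n$ share an orthonormal eigenbasis $\{u_k\}_{k=1}^N$ of $\mathcal H$ and satisfy $$Q_iu_k=\lambda_{i,k}u_k,\qquad 0\le\lambda_{i,k}\le1 .$$ Let $f=\sum_{k=1}^N\theta_ku_k$ and define $$a_{j,k}:=\prod_{i=1}^j(1-\lambda_{i,k}),\qquad j=1,\dots,n .$$ Then, for $j=1,\dots,n$, $$\operatorname{IBias}^2_j=\sum_{k=1}^Na_{j,k}^2\theta_k^2,\qquad \operatorname{IVar}_j=\sigma^2\sum_{k=1}^N(1-a_{j,k})^2 .$$ Define $$\operatorname{IBr}_j:=\frac{\operatorname{IBias}^2_j}{\operatorname{IBias}^2_j+\operatorname{IVar}_j}$$ whenever the denominator is nonzero. Then $\operatorname{IBias}^2_j$ is nonincreasing in $j$, $\operatorname{IVar}_j$ is nondecreasing in $j$, and $\operatorname{IBr}_j$ is nonincreasing in $j$.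
   Context: The data sites $X$ and the level operators are fixed; $\mathbb{E}$ is the expectation with respect to the noise $\varepsilon$ only. Multiscale recursion: $M_0=0$, $E_0=I$, and for $i=1,\dots,n$: $M_if=M_{i-1}f+Q_iE_{i-1}f$, $E_if=E_{i-1}f-Q_iE_{i-1}f$. Integrated quantities after $j$ levels are sums over the data sites (no normalization): $\operatorname{IBias}^2_j=\sum_{x\in X}(f(x)-\mathbb{E}[\widetilde f_j(x)])^2$ and $\operatorname{IVar}_j=\sum_{x\in X}\mathbb{E}[(\widetilde f_j(x)-\mathbb{E}[\widetilde f_j(x)])^2]$. *)

(* Defs.v *)
From HB Require Import structures.
From mathcomp Require Import all_boot all_order all_algebra finmap.
From mathcomp Require Import all_classical all_reals all_analysis.

Set Implicit Arguments.
Unset Strict Implicit.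
Unset Printing Implicit Defensive.

Import Order.TTheory GRing.Theory Num.Theory.

Local Open Scope ring_scope.

(* R^o rather than R, so that the R-vector space structure is found. *)
Notation signal X R := {ffun X -> R^o}.

Section Signals.
Context {R : realType} {d : nat} {X : {fset 'rV[R]_d}}.
Implicit Types (f g : signal X R) (Q : nat -> 'End(signal X R)).

Definition inner f g : R := \sum_(x : X) (f x : R) * (g x : R).

Definition orthonormal_basis {N : nat} (u : 'I_N -> signal X R) : Prop :=
  (forall k l : 'I_N, inner (u k) (u l) = (k == l)%:R) /\
  basis_of fullv [seq u k | k <- enum 'I_N].

(* The residual operators E_i and approximation operators M_i.  The levels
   start at 1; the value Q 0 is never used. *)
Fixpoint residual_op Q (i : nat) : 'End(signal X R) :=
  if i is i'.+1 then residual_op Q i' - (Q i'.+1 \o residual_op Q i')%VF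
  else \1%VF.

Fixpoint approx_op Q (i : nat) : 'End(signal X R) :=
  if i is i'.+1 then approx_op Q i' + (Q i'.+1 \o residual_op Q i')%VF
  else 0.

Section Noise.
Context {dO : measure_display} {Omega : measurableType dO}.
Variable P : probability Omega R.
Implicit Type eps : Omega -> signal X R.

Definition random_signal eps : Prop :=
  forall x : X, measurable_fun [set: Omega] (fun w => eps w x : R).

Definition mean_zero eps : Prop :=
  forall x : X, expectation P (fun w => eps w x : R) = 0%:E.

(* Square integrability of the coordinates is not asked for separately: for a
   measurable eps of mean zero it follows from the diagonal entries. *)
Definition isotropic_covariance eps (sigma : R) : Prop :=
  forall x y : X,
    covariance P (fun w => eps w x : R) (fun w => eps w y : R)
    = (sigma ^+ 2 * (x == y)%:R)%:E.

Definition estimator Q f eps (j : nat) (w : Omega) : signal X R :=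
  approx_op Q j (f + eps w).

(* The integrated quantities are extended reals, so that no finiteness is
   presupposed. *)
Definition IBias2 Q f eps (j : nat) : \bar R :=
  (\sum_(x : X)
    ((f x : R)%:E
       - expectation P (fun w => estimator Q f eps j w x : R)) ^+ 2)%E.

Definition IVar Q f eps (j : nat) : \bar R :=
  (\sum_(x : X) variance P (fun w => estimator Q f eps j w x : R))%E.

(* Meaningful only when the denominator is nonzero. *)
Definition IBr Q f eps (j : nat) : \bar R :=
  (IBias2 Q f eps j / (IBias2 Q f eps j + IVar Q f eps j))%E.

End Noise.
End Signals.

(* Main.v *)
Require Import Defs.
From HB Require Import structures.
From mathcomp Require Import all_boot all_order all_algebra finmap.
From mathcomp Require Import all_classical all_reals all_analysis.
From mathcomp Require Import ring lra.
Import Order.TTheory GRing.Theory Num.Theory.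
Local Open Scope ring_scope.

(** All the level operators are diagonal in the basis [u], so the residual
    operator E_j multiplies [u k] by the product a_(j,k) of the factors
    1 - lambda_(i,k), and M_j = I - E_j multiplies it by 1 - a_(j,k).

    Bias: the noise has mean zero, so f - E[M_j Y] = E_j f, whose squared norm
    is the sum of a_(j,k)^2 theta_k^2 by Parseval ([parseval]).

    Variance: M_j Y at a site x is a constant plus a linear combination of the
    noise coordinates, whose coefficients are the entries m_(x,y) of the matrix
    of M_j at the data sites.  As the noise coordinates are uncorrelated with
    variance sigma^2, the variance at x is sigma^2 times the sum over y of
    m_(x,y)^2 ([affine_noise]).  Summing over x gives the squared Frobenius norm
    of M_j, which is the sum of the squares of its eigenvalues
    ([kernel_frobenius]).

    Monotonicity: the factors lie in [0, 1], so a_(j,k) is nonincreasing in j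
    and stays in [0, 1]; hence the bias is nonincreasing and the variance
    nondecreasing.  For nonnegative b and v with b + v > 0, the ratio
    b / (b + v) is nondecreasing in b and nonincreasing in v
    ([bias_ratio_le]). *)

(** * Diagonal operators in an orthonormal basis *)

Section Orthonormal.
Context {R : realType} {d N : nat} {X : {fset 'rV[R]_d}}.
Implicit Types (v : signal X R) (u : 'I_N -> signal X R).

Lemma inner_suml {u} (c : 'I_N -> R) v :
  inner (\sum_k c k *: u k) v = \sum_k c k * inner (u k) v.
Proof.
under [RHS]eq_bigr do rewrite /inner mulr_sumr.
rewrite exchange_big; apply: eq_bigr => x _ /=.
rewrite sum_ffunE mulr_suml; apply: eq_bigr => k _.
by rewrite !ffunE mulrA.
Qed.

Lemma innerC (v w : signal X R) : inner v w = inner w v.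
Proof. by apply: eq_bigr => x _; rewrite mulrC. Qed.

Lemma inner_orthonormal_sum {u} : orthonormal_basis u ->
  forall (c : 'I_N -> R) (k : 'I_N), inner (u k) (\sum_l c l *: u l) = c k.
Proof.
move=> [uo _] c k; rewrite innerC inner_suml (bigD1 k) //= uo eqxx mulr1.
by rewrite big1 ?addr0 // => l /negbTE lk; rewrite uo lk mulr0.
Qed.

Lemma parseval {u} : orthonormal_basis u -> forall c : 'I_N -> R,
  inner (\sum_k c k *: u k) (\sum_k c k *: u k) = \sum_k c k ^+ 2.
Proof.
move=> uP c; rewrite inner_suml; apply: eq_bigr => k _.
by rewrite inner_orthonormal_sum // expr2.
Qed.

Lemma orthonormal_expand {u} : orthonormal_basis u ->
  forall v, v = \sum_k inner (u k) v *: u k.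
Proof.
move=> uP v.
have [c vE] : exists c : 'I_N -> R, v = \sum_k c k *: u k.
  have uB : basis_of fullv (map_tuple u (ord_tuple N)).
    exact: uP.2.
  exists (fun k => coord (map_tuple u (ord_tuple N)) k v).
  rewrite {1}(coord_basis uB (memvf v)); apply: eq_bigr => k _.
  by rewrite -tnth_nth tnth_map tnth_ord_tuple.
rewrite {1}vE; apply: eq_bigr => k _; congr (_ *: _).
by rewrite vE inner_orthonormal_sum.
Qed.

(** The row at site [x] of the matrix of the operator with eigenvalues [b] in
    the basis [u]: its entry at [y] is the sum of b_k u_k(x) u_k(y). *)
Definition kernel_row u (b : 'I_N -> R) (x : X) : signal X R :=
  \sum_k (b k * u k x) *: u k.

Lemma diagonal_op_kernel {u} {b : 'I_N -> R} {L : 'End(signal X R)} :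
    orthonormal_basis u -> (forall k, L (u k) = b k *: u k) ->
  forall v x, L v x = inner (kernel_row u b x) v.
Proof.
move=> uP Lu v x; rewrite inner_suml {1}(orthonormal_expand uP v).
rewrite linear_sum sum_ffunE; apply: eq_bigr => k _.
rewrite linearZ /= Lu !ffunE.
by rewrite [RHS]mulrC; congr (_ * _).
Qed.

(** The squared Frobenius norm is the sum of the squared eigenvalues: each row
    has squared norm the sum of (b_k u_k(x))^2 by Parseval, and every u_k has
    norm 1. *)
Lemma kernel_frobenius {u} : orthonormal_basis u -> forall b : 'I_N -> R,
  \sum_(x : X) \sum_(y : X) (kernel_row u b x y : R) ^+ 2 = \sum_k b k ^+ 2.
Proof.
move=> uP b.
transitivity (\sum_(x : X) \sum_k (b k * u k x) ^+ 2).
  apply: eq_bigr => x _; rewrite -(parseval uP).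
  by apply: eq_bigr => y _; rewrite expr2.
rewrite exchange_big; apply: eq_bigr => k _ /=.
under eq_bigr do rewrite exprMn.
rewrite -mulr_sumr -[RHS]mulr1; congr (_ * _).
have <- : inner (u k) (u k) = 1 by rewrite uP.1 eqxx.
by apply: eq_bigr => x _; rewrite expr2.
Qed.
End Orthonormal.

(** * The multiscale recursion *)

Section Multiscale.
Context {R : realType} {d : nat} {X : {fset 'rV[R]_d}}.
Implicit Types (Q : nat -> 'End(signal X R)).

Lemma approx_opE Q j v : approx_op Q j v = v - residual_op Q j v.
Proof.
elim: j => [|j IH] /=; first by rewrite zero_lfunE id_lfunE subrr.
by rewrite !lfunE /= !lfunE /= IH !lfunE /= opprB addrA addrAC.
Qed.

(** The factor by which the residual operator after [j] levels multiplies the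
    [k]-th eigenvector. *)
Definition residual_factor {N} (lambda : nat -> 'I_N -> R)
    (j : nat) (k : 'I_N) : R :=
  \prod_(1 <= i < j.+1) (1 - lambda i k).

Section Eigen.
Context {N n : nat} {Q : nat -> 'End(signal X R)}.
Context {u : 'I_N -> signal X R} {lambda : nat -> 'I_N -> R}.
Hypothesis Q_eigen : forall i k, (1 <= i <= n)%N -> Q i (u k) = lambda i k *: u k.
Hypothesis lambda_01 : forall i k, (1 <= i <= n)%N -> 0 <= lambda i k <= 1.
Local Notation a := (residual_factor lambda).

Lemma residual_factorS j k : a j.+1 k = a j k * (1 - lambda j.+1 k).
Proof. by rewrite /residual_factor big_nat_recr. Qed.

Lemma residual_op_eigen j k : (j <= n)%N ->
  residual_op Q j (u k) = a j k *: u k.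
Proof.
elim: j => [_|j IH jn] /=.
  by rewrite id_lfunE /residual_factor big_geq // scale1r.
rewrite !lfunE /= !lfunE /= !lfunE /= IH ?(ltnW jn) // linearZ /= Q_eigen //.
by rewrite residual_factorS scalerA -scalerBl mulrBr mulr1.
Qed.

Lemma approx_op_eigen j k : (j <= n)%N ->
  approx_op Q j (u k) = (1 - a j k) *: u k.
Proof. by move=> jn; rewrite approx_opE residual_op_eigen // scalerBl scale1r. Qed.

Lemma residual_factor_ge0 j k : (j <= n)%N -> 0 <= a j k.
Proof.
elim: j => [_|j IH jn]; first by rewrite /residual_factor big_geq.
rewrite residual_factorS mulr_ge0 ?IH ?(ltnW jn) // subr_ge0.
by have /andP[] := lambda_01 j.+1 k jn.
Qed.

Lemma residual_factor_nonincreasing i j k : (i <= j)%N -> (j <= n)%N ->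
  a j k <= a i k.
Proof.
elim: j => [|j IH]; first by rewrite leqn0 => /eqP ->.
rewrite leq_eqVlt => /predU1P[-> //|ij] jn.
apply: le_trans (IH ij (ltnW jn)).
rewrite residual_factorS ler_piMr ?residual_factor_ge0 ?(ltnW jn) //.
by rewrite gerBl; have /andP[] := lambda_01 j.+1 k jn.
Qed.

Lemma residual_factor_le1 j k : (j <= n)%N -> a j k <= 1.
Proof.
move=> jn; apply: le_trans (residual_factor_nonincreasing 0 _ _ _ jn) _ => //.
by rewrite /residual_factor big_geq.
Qed.
End Eigen.
End Multiscale.

(** * Moments of affine functions of white noise *)

Section Noise.
Context {dO : measure_display} {Omega : measurableType dO} {R : realType}.
Variable P : probability Omega R.
Local Notation integrable1 Z := (P.-integrable [set: Omega] (EFin \o Z)).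

Lemma expectation_affine {I : finType} (c : R) (m : I -> R) (Z : I -> Omega -> R) :
    (forall i, integrable1 (Z i)) ->
  expectation P (fun w => c + \sum_i m i * Z i w)
    = (c%:E + \sum_i (m i)%:E * expectation P (Z i))%E.
Proof.
move=> Zint.
have Zint' i : P.-integrable [set: Omega] (fun w => ((m i)%:E * (Z i w)%:E)%E).
  by apply: integrableZl => //; exact: Zint.
rewrite unlock.
under eq_integral => w _.
  rewrite EFinD -sumEFin; under eq_bigr do rewrite EFinM.
  over.
rewrite integralD //=; last 2 first.
- exact: finite_measure_integrable_cst.
- by apply: integrable_sum.
have -> : (\int[P]_w c%:E = c%:E)%E.
  by have := expectation_cst P c; rewrite unlock.
rewrite integral_sum //; congr (_ + _)%E; apply: eq_bigr => i _.
by rewrite integralZl //; exact: Zint.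
Qed.

(** Cauchy-Schwarz for square integrable functions, in the weak form
    |YZ| <= Y^2 + Z^2. *)
Lemma integrable_mul (Y Z : Omega -> R) :
    measurable_fun [set: Omega] Y -> measurable_fun [set: Omega] Z ->
    integrable1 (fun w => Y w ^+ 2) -> integrable1 (fun w => Z w ^+ 2) ->
  integrable1 (fun w => Y w * Z w).
Proof.
move=> mY mZ Y2 Z2.
apply: le_integrable (integrableD measurableT Y2 Z2) => //.
  by apply/measurable_realfun.measurable_EFinP; exact: measurable_realfun.measurable_funM.
move=> w _ /=; rewrite lee_fin [leRHS]ger0_norm ?addr_ge0 ?sqr_ge0 //.
rewrite normrM -[X in _ <= X + _]real_normK ?num_real //.
rewrite -[X in _ <= _ + X]real_normK ?num_real //.
have := normr_ge0 (Y w); have := normr_ge0 (Z w); nra.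
Qed.

(** For a centered variable the variance is the integral of the square, so a
    finite variance gives square integrability. *)
Lemma integrable_sqr (Z : Omega -> R) s : measurable_fun [set: Omega] Z ->
    expectation P Z = 0%:E -> variance P Z = s%:E ->
  integrable1 (fun w => Z w ^+ 2).
Proof.
move=> mZ EZ VZ; apply/integrableP; split.
  by apply/measurable_realfun.measurable_EFinP; exact: measurable_realfun.measurable_funX.
suff -> : (\int[P]_w `|(Z w ^+ 2)%:E| = s%:E)%E by rewrite ltry.
rewrite -VZ /variance covariance.unlock EZ expectation.unlock.
apply: eq_integral => w _ /=.
by rewrite ger0_norm ?sqr_ge0 // !fctE /= subr0 expr2.
Qed.

(** Mean and variance of an affine function of centered uncorrelated variables
    of common variance [s ^+ 2]. *)
Lemma affine_noise {I : finType} (c s : R) (m : I -> R) (Z : I -> Omega -> R) :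
    (forall i, measurable_fun [set: Omega] (Z i)) ->
    (forall i, expectation P (Z i) = 0%:E) ->
    (forall i j, covariance P (Z i) (Z j) = (s ^+ 2 * (i == j)%:R)%:E) ->
  let Y := fun w => c + \sum_i m i * Z i w in
  expectation P Y = c%:E /\ variance P Y = (s ^+ 2 * \sum_i m i ^+ 2)%:E.
Proof.
move=> mZ EZ covZ Y.
have Z2 i : integrable1 (fun w => Z i w ^+ 2).
  by apply: integrable_sqr (mZ i) (EZ i) (covZ i i).
have Z1 i : integrable1 (Z i).
  (* [integrable_mul] with the constant 1, as the measure is finite *)
  have -> : Z i = fun w => Z i w * cst 1 w by apply/funext => w; rewrite mulr1.
  apply: integrable_mul => //.
  by under eq_fun do rewrite expr1n; exact: finite_measure_integrable_cst.
have EZZ i j : expectation P (fun w => Z i w * Z j w) = (s ^+ 2 * (i == j)%:R)%:E.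
  rewrite -covZ covariance.unlock !EZ /=; congr (expectation P _).
  by apply/funext => w; rewrite !fctE /= !subr0.
have EY : expectation P Y = c%:E.
  rewrite expectation_affine // big1 ?addr0 ?adde0 // => i _.
  by rewrite EZ mule0.
split=> //; rewrite /variance covariance.unlock EY /=.
(* the square of the linear part, as a sum over pairs of indices *)
rewrite [X in expectation P X](_ : _ = fun w =>
    0 + \sum_(p : I * I) (m p.1 * m p.2) * (Z p.1 w * Z p.2 w)); last first.
  apply/funext => w; rewrite !fctE /= /Y addrAC subrr !add0r.
  rewrite big_distrlr pair_big /=; apply: eq_bigr => p _; ring.
rewrite (expectation_affine 0 (fun p : I * I => m p.1 * m p.2)
  (fun p w => Z p.1 w * Z p.2 w)); last by move=> p; exact: integrable_mul.
rewrite /=; under eq_bigr do rewrite EZZ -EFinM.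
rewrite sumEFin add0e; congr EFin.
rewrite -(pair_bigA _ (fun i j => m i * m j * (s ^+ 2 * (i == j)%:R))) /=.
rewrite mulr_sumr; apply: eq_bigr => i _.
rewrite (bigD1 i) //= eqxx big1 ?addr0 => [|j /negbTE ji]; first by rewrite mulr1; ring.
by rewrite eq_sym ji !mulr0.
Qed.
End Noise.

(** * Integrated bias, variance and bias ratio *)

Lemma bias_ratio_le {R : realFieldType} (b b' v v' : R) :
    0 <= b' -> b' <= b -> 0 <= v -> v <= v' -> b + v != 0 -> b' + v' != 0 ->
  b' / (b' + v') <= b / (b + v).
Proof.
move=> b'0 b'b v0 vv' d0 d'0.
have dp : 0 < b + v by rewrite lt_def d0; lra.
have d'p : 0 < b' + v' by rewrite lt_def d'0; lra.
rewrite ler_pdivrMr // mulrAC ler_pdivlMr //.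
have := ler_pM b'0 v0 b'b vv'; nra.
Qed.

Section Integrated.
Context {R : realType} {d N n : nat} {X : {fset 'rV[R]_d}}.
Context {Q : nat -> 'End(signal X R)} {f : signal X R}.
Context {dO : measure_display} {Omega : measurableType dO}.
Context {P : probability Omega R} {eps : Omega -> signal X R} {sigma : R}.
Context {u : 'I_N -> signal X R} {lambda : nat -> 'I_N -> R}.
Hypothesis eps_rand : random_signal eps.
Hypothesis eps_mean : mean_zero P eps.
Hypothesis eps_cov : isotropic_covariance P eps sigma.
Hypothesis u_basis : orthonormal_basis u.
Hypothesis Q_eigen : forall i k, (1 <= i <= n)%N -> Q i (u k) = lambda i k *: u k.
Local Notation a := (residual_factor lambda).

Lemma estimator_moments j (x : X) : (j <= n)%N ->
  let est := fun w => estimator Q f eps j w x : R in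
  expectation P est = (approx_op Q j f x : R)%:E /\
  variance P est
    = (sigma ^+ 2 *
        \sum_(y : X) (kernel_row u (fun k => 1 - a j k) x y : R) ^+ 2)%:E.
Proof.
move=> jn est; set m := kernel_row _ _ x.
have -> : est = fun w => approx_op Q j f x + \sum_y m y * eps w y.
  apply/funext => w; rewrite /est /estimator linearD ffunE; congr (_ + _).
  rewrite (diagonal_op_kernel (b := fun k => 1 - a j k) u_basis) //.
  by move=> k; rewrite (approx_op_eigen Q_eigen).
exact: (affine_noise P _ sigma m (fun y w => eps w y) eps_rand eps_mean eps_cov).
Qed.

Lemma IVarE j : (j <= n)%N ->
  IVar P Q f eps j = (sigma ^+ 2 * \sum_(k < N) (1 - a j k) ^+ 2)%:E.
Proof.
move=> jn; rewrite /IVar.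
under eq_bigr do rewrite (estimator_moments j _ jn).2.
by rewrite sumEFin -mulr_sumr kernel_frobenius.
Qed.

Lemma IBias2E (theta : 'I_N -> R) j : (j <= n)%N ->
    f = \sum_(k < N) theta k *: u k ->
  IBias2 P Q f eps j = (\sum_(k < N) a j k ^+ 2 * theta k ^+ 2)%:E.
Proof.
move=> jn fE.
have Ef : residual_op Q j f = \sum_k (a j k * theta k) *: u k.
  rewrite fE linear_sum; apply: eq_bigr => k _.
  by rewrite linearZ /= (residual_op_eigen Q_eigen) // scalerA mulrC.
rewrite /IBias2.
under eq_bigr => x _.
  rewrite (estimator_moments j _ jn).1 approx_opE !ffunE.
  rewrite -EFinB opprB addrCA subrr addr0 -EFin_expe.
  over.
rewrite sumEFin; congr EFin.
under [RHS]eq_bigr do rewrite -exprMn.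
rewrite -(parseval u_basis) -Ef; apply: eq_bigr => x _.
by rewrite -expr2.
Qed.
End Integrated.

Theorem theorem3p6 (R : realType) (d N n : nat) (X : {fset 'rV[R]_d})
    (cardX : #|` X| = N)
    (Q : nat -> 'End(signal X R))
    (dO : measure_display) (Omega : measurableType dO)
    (P : probability Omega R)
    (f : signal X R) (eps : Omega -> signal X R) (sigma : R)
    (eps_rand : random_signal eps)
    (eps_mean : mean_zero P eps)
    (eps_cov : isotropic_covariance P eps sigma)
    (u : 'I_N -> signal X R) (lambda : nat -> 'I_N -> R) (theta : 'I_N -> R)
    (u_basis : orthonormal_basis u)
    (Q_eigen : forall (i : nat) (k : 'I_N), (1 <= i <= n)%N ->
       Q i (u k) = lambda i k *: u k)
    (lambda_01 : forall (i : nat) (k : 'I_N), (1 <= i <= n)%N ->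
       0 <= lambda i k <= 1)
    (f_coord : f = \sum_(k < N) theta k *: u k) :
  let a (j : nat) (k : 'I_N) : R := \prod_(1 <= i < j.+1) (1 - lambda i k) in
  [/\ forall j : nat, (1 <= j <= n)%N ->
        IBias2 P Q f eps j = (\sum_(k < N) a j k ^+ 2 * theta k ^+ 2)%:E /\
        IVar P Q f eps j = (sigma ^+ 2 * \sum_(k < N) (1 - a j k) ^+ 2)%:E,
      forall i j : nat, (1 <= i)%N -> (i <= j)%N -> (j <= n)%N ->
        (IBias2 P Q f eps j <= IBias2 P Q f eps i)%E,
      forall i j : nat, (1 <= i)%N -> (i <= j)%N -> (j <= n)%N ->
        (IVar P Q f eps i <= IVar P Q f eps j)%E
    & forall i j : nat, (1 <= i)%N -> (i <= j)%N -> (j <= n)%N ->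
        (IBias2 P Q f eps i + IVar P Q f eps i != 0)%E ->
        (IBias2 P Q f eps j + IVar P Q f eps j != 0)%E ->
        (IBr P Q f eps j <= IBr P Q f eps i)%E].
Proof.
move=> a.
have IB j (jn : (j <= n)%N) :=
  IBias2E eps_rand eps_mean eps_cov u_basis Q_eigen theta j jn f_coord.
have IV j (jn : (j <= n)%N) :=
  IVarE (f := f) eps_rand eps_mean eps_cov u_basis Q_eigen j jn.
have a_ge0 j k : (j <= n)%N -> 0 <= a j k by exact: residual_factor_ge0.
have a_le1 j k : (j <= n)%N -> a j k <= 1 by exact: residual_factor_le1.
have a_le i j k : (i <= j)%N -> (j <= n)%N -> a j k <= a i k.
  exact: residual_factor_nonincreasing.
have B_le i j : (i <= j)%N -> (j <= n)%N ->
    \sum_(k < N) a j k ^+ 2 * theta k ^+ 2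
      <= \sum_(k < N) a i k ^+ 2 * theta k ^+ 2.
  move=> ij jn; apply: ler_sum => k _.
  by rewrite ler_wpM2r ?sqr_ge0 // lerXn2r ?nnegrE ?a_ge0 ?a_le // (leq_trans ij).
have V_le i j : (i <= j)%N -> (j <= n)%N ->
    sigma ^+ 2 * \sum_(k < N) (1 - a i k) ^+ 2
      <= sigma ^+ 2 * \sum_(k < N) (1 - a j k) ^+ 2.
  move=> ij jn; rewrite ler_wpM2l ?sqr_ge0 //; apply: ler_sum => k _.
  rewrite lerXn2r ?nnegrE ?subr_ge0 ?a_le1 // ?(leq_trans ij) //.
  by rewrite lerB ?a_le.
split.
- by move=> j /andP[_ jn]; rewrite IB // IV.
- by move=> i j _ ij jn; rewrite !IB ?(leq_trans ij) // lee_fin B_le.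
- by move=> i j _ ij jn; rewrite !IV ?(leq_trans ij) // lee_fin V_le.
- move=> i j _ ij jn; rewrite /IBr !IB ?IV ?(leq_trans ij) //.
  rewrite -!EFinD !eqe => di dj.
  rewrite !inver (negbTE di) (negbTE dj) -!EFinM lee_fin.
  apply: bias_ratio_le => //; [|exact: B_le| |exact: V_le].
    by apply: sumr_ge0 => k _; rewrite mulr_ge0 ?sqr_ge0.
  by rewrite mulr_ge0 ?sqr_ge0 // sumr_ge0 // => k _; exact: sqr_ge0.
Qed.
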